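(* A loopless matroid $M$ of rank $r$ is binary if and only if each of its rainbow circuit-free colorings with exactly $r$ colors is standard.
   Context: A coloring of the ground set $S$ is a partition of $S$ into nonempty color classes; it is rainbow circuit-free if no circuit of $M$ has all its elements of pairwise different colors. A coloring of a rank-$r$ matroid $M$ with color classes $S_1,\dots,S_r$ is standard if, after possibly reindexing the classes, $S_i$ is a cut of the restriction $M|(S_1\cup\dots\cup S_i)$ for every $i=1,\dots,r$. A cut is an inclusionwise minimal subset of the ground set intersecting every basis. A matroid is binary if it is representable over $GF(2)$. *)

(* Defs.v *)
From HB Require Import structures.
From mathcomp Require Import all_boot all_order all_algebra all_fingroup.
Set Implicit Arguments. Unset Strict Implicit. Unset Printing Implicit Defensive.
Import GRing.Theory.

Record matroid (T : finType) := Matroid {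
  indep : {set T} -> bool;
  indep0 : indep set0;
  indep_sub : forall A B : {set T}, A \subset B -> indep B -> indep A;
  indep_aug : forall A B : {set T}, indep A -> indep B -> #|A| < #|B| ->
      exists2 x, x \in B :\: A & indep (x |: A)
}.

Section MatroidDefs.
Variables (T : finType) (M : matroid T).

Definition mrank : nat := \max_(A : {set T} | indep M A) #|A|.

Definition circuit (C : {set T}) : bool :=
  ~~ indep M C && [forall x in C, indep M (C :\ x)].

Definition loopless : Prop := forall x : T, indep M [set x].

Definition basis_in (X B : {set T}) : bool :=
  maxset (fun B' : {set T} => (B' \subset X) && indep M B') B.

Definition cut_in (X D : {set T}) : bool :=
  minset (fun D' : {set T} => (D' \subset X) &&
             [forall B : {set T}, basis_in X B ==> (D' :&: B != set0)]) D.

Definition coloring (P : {set {set T}}) : bool := partition P [set: T].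

Definition rainbow (P : {set {set T}}) (C : {set T}) : bool :=
  [forall S in P, #|C :&: S| <= 1].

Definition rainbow_circuit_free (P : {set {set T}}) : bool :=
  [forall C : {set T}, circuit C ==> ~~ rainbow P C].

Definition standard (P : {set {set T}}) : Prop :=
  exists S : 'I_mrank -> {set T},
    [/\ injective S, P = [set S i | i : 'I_mrank] &
        forall i : 'I_mrank,
          cut_in (\bigcup_(j : 'I_mrank | j <= i) S j) (S i)].

End MatroidDefs.

Definition binary (T : finType) (M : matroid T) : Prop :=
  exists (n : nat) (v : T -> 'rV['F_2]_n),
    forall A : {set T},
      indep M A = row_free (\matrix_(i < #|A|) v (@enum_val T (mem A) i)).

(* Main.v *)
Require Import Defs.
From mathcomp Require Import all_boot all_order all_algebra.
From mathcomp Require Import zify.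
Set Implicit Arguments. Unset Strict Implicit. Unset Printing Implicit Defensive.
Import GRing.Theory.

(** If [M] is binary, take coordinates over GF(2) with respect to a transversal
    of the coloring. Rainbow circuit-freeness says that all transversals are
    nonsingular, which makes the digraph of nonzero off-diagonal coordinates
    between colors acyclic; a topological order of the colors is standard.

    Conversely, if all such colorings are standard then no contraction [M / Z]
    of rank 2 has four points: color the closure of [Z] along a complete flag and
    put two points of [M / Z] in one further class and the others in another;
    neither of these two classes can be a cut. Without four-point lines, the pairs
    forming bases of [M / Z] obey the two-by-two determinant rule of GF(2), so
    [M] and the binary matroid of the fundamental circuits of a basis [B] have
    the same fundamental circuits also at every basis reached from [B] by
    exchanges, that is, at every basis. *)

(** * Bases, exchange and closure in a matroid *)

Section MatroidTheory.
Variables (T : finType) (M : matroid T).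
Implicit Types A B C I Z : {set T}.

Definition basis A := indep M A && (#|A| == mrank M).

Lemma indep_leq_mrank A : indep M A -> #|A| <= mrank M.
Proof. by move=> iA; rewrite /mrank (bigmax_sup A). Qed.

Lemma indep_extend A B : indep M A -> indep M B ->
  exists A' : {set T}, [/\ A \subset A', A' \subset A :|: B, indep M A' & #|B| <= #|A'|].
Proof.
move: {2}(#|B| - #|A|) (leqnn (#|B| - #|A|)) => n.
elim: n A => [|n IH] A le_n iA iB.
  by exists A; split=> //; [apply: subsetUl | rewrite -subn_eq0 -leqn0].
have [leBA|ltAB] := leqP #|B| #|A|.
  by exists A; split=> //; apply: subsetUl.
have [x /setDP[xB xA] ixA] := indep_aug iA iB ltAB.
have [|A' [sub1 sub2 iA' leBA']] := IH (x |: A) _ ixA iB.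
  by rewrite cardsU1 xA; lia.
exists A'; split=> //; first exact: subset_trans (subsetUr _ _) sub1.
apply: subset_trans sub2 _; rewrite !subUset subsetUl subsetUr sub1set !inE xB.
by rewrite orbT.
Qed.

Lemma basis_exists : exists B, basis B.
Proof.
have gt0 : 0 < #|[pred A | indep M A]|.
  by apply/card_gt0P; exists set0; rewrite inE indep0.
have [B iB eB] := eq_bigmax_cond (fun A => #|A|) gt0.
exists B; rewrite /basis /mrank; rewrite inE in iB.
by rewrite iB -eB; apply/eqP; apply: eq_bigl => A; rewrite inE.
Qed.

Lemma indep_basisP A : reflect (exists2 B : {set T}, A \subset B & basis B) (indep M A).
Proof.
apply: (iffP idP) => [iA|[B sAB /andP[iB _]]]; last exact: indep_sub iB.
have [B /andP[iB /eqP eB]] := basis_exists.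
have [A' [sAA' _ iA' leB]] := indep_extend iA iB.
by exists A' => //; rewrite /basis iA' eqn_leq indep_leq_mrank // -eB.
Qed.

Lemma basis_exchange A B b : basis A -> basis B -> b \in B :\: A ->
  exists2 x, x \in A :\: B & basis (x |: (B :\ b)).
Proof.
move=> /andP[iA /eqP cA] /andP[iB /eqP cB] /setDP[bB bA].
have cBb := cardsD1 b B; rewrite bB in cBb.
have iBb : indep M (B :\ b) by apply: indep_sub iB; apply: subsetDl.
have [|x /setDP[xA]] := indep_aug iBb iA; first by lia.
have xb : x != b by apply: contraNneq bA => <-.
rewrite !inE xb /= => xB ixBb; exists x; first by rewrite inE xB.
by rewrite /basis ixBb cardsU1 !inE xb xB /=; apply/eqP; lia.
Qed.

Lemma circuit_exists A : ~~ indep M A -> exists2 C : {set T}, C \subset A & circuit M C.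
Proof.
move=> dA; have [C /minsetP[dC minC] sCA] := @minset_exists _ (fun X => ~~ indep M X) A dA.
exists C => //; rewrite /circuit dC; apply/forall_inP=> x xC.
apply: contraT => dCx; have := minC _ dCx (subsetDl _ _).
by move/setP/(_ x); rewrite !inE eqxx xC.
Qed.

(** Membership in the closure of [I], meant for independent [I]: a dependent [I] would span every
    element. *)
Definition spans I x := (x \in I) || ~~ indep M (x |: I).

Lemma spans_card I A : indep M I -> indep M A ->
  {in A, forall x, spans I x} -> #|A| <= #|I|.
Proof.
move=> iI iA sA; rewrite leqNgt; apply/negP=> ltIA.
have [x /setDP[xA xI] ixI] := indep_aug iI iA ltIA.
by have := sA x xA; rewrite /spans (negPf xI) ixI.
Qed.

(** If [x] could be added to [I], then [C :\ x] would extend, by elements of [x |: I], to an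
    independent set [A] larger than [I]. As [A] cannot contain [C], it omits [x] and consists of
    elements spanned by [I], so it is too large. *)
Lemma circuit_spans I C x : indep M I -> circuit M C -> x \in C ->
  {in C :\ x, forall y, spans I y} -> spans I x.
Proof.
move=> iI /andP[dC /forall_inP mC] xC sC; apply/contraT => /norP[xI /negbNE ixI].
have [A [sCA sAU iA leA]] := indep_extend (mC x xC) ixI.
have xA : x \notin A.
  apply: contra dC => xA; apply: indep_sub iA.
  by rewrite -(setD1K xC) subUset sub1set xA.
suff : #|A| <= #|I| by move: leA; rewrite cardsU1 xI; lia.
apply: spans_card => // y yA; have := subsetP sAU y yA.
rewrite in_setU => /orP[/sC //|]; rewrite in_setU1 => /orP[/eqP yx|yI].
  by rewrite -yx yA in xA.
by rewrite /spans yI.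
Qed.

(** Extend [I], by elements of [Z] and by [p] and [q], to at least [#|Z| + 2] elements. Those other
    than [p] and [q] are spanned by [Z], hence at most [#|Z|] many, so both [p] and [q] occur. *)
Lemma indep_add2 Z I p q : indep M (p |: (q |: Z)) -> #|p |: (q |: Z)| = #|Z|.+2 ->
  indep M I -> {in I, forall x, spans Z x} -> indep M (p |: (q |: I)).
Proof.
move=> ipqZ cpqZ iI sI.
have iZ : indep M Z by apply: indep_sub ipqZ; rewrite setUA subsetUr.
have [A [sIA sAU iA leA]] := indep_extend iI ipqZ.
have leD : #|A :\ p :\ q| <= #|Z|.
  apply: spans_card => [||y] //.
    by apply: indep_sub iA; rewrite (subset_trans (subsetDl _ _)) ?subsetDl.
  rewrite !inE => /and3P[yq yp yA]; have := subsetP sAU y yA.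
  rewrite !inE (negPf yp) (negPf yq) /= => /orP[/sI //|yZ].
  by rewrite /spans yZ.
have := cardsD1 p A; have := cardsD1 q (A :\ p); rewrite !inE => e1 e2.
have [pA qA] : p \in A /\ q \in A.
  by case: (p \in A) e2; case: (q \in A) e1; rewrite ?andbF ?andbT /=; lia.
by apply: indep_sub iA; rewrite !subUset !sub1set pA qA.
Qed.

End MatroidTheory.

(** * Matroids represented by vectors over a field *)

Section VectorMatroid.
Variables (F : fieldType) (T : finType) (n : nat) (v : T -> 'rV[F]_n).
Implicit Types A B : {set T}.
Local Open Scope ring_scope.

Definition vspan A : 'M[F]_n := (\sum_(x in A) <<v x>>)%MS.

Lemma vspan_subP m A (W : 'M_(m, n)) :
  reflect {in A, forall x, (v x <= W)%MS} (vspan A <= W)%MS.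
Proof.
by apply: (iffP sumsmx_subP) => H x xA; have := H x xA; rewrite genmxE.
Qed.

Lemma vspan_mem A x : x \in A -> (v x <= vspan A)%MS.
Proof. by move=> xA; rewrite -genmxE (sumsmx_sup x). Qed.

Lemma vspanS A B : A \subset B -> (vspan A <= vspan B)%MS.
Proof. by move=> sAB; apply/vspan_subP=> x xA; rewrite vspan_mem ?(subsetP sAB). Qed.

Lemma vspanU1 x A : (vspan (x |: A) == v x + vspan A)%MS.
Proof.
apply/andP; split.
  apply/vspan_subP=> y /setU1P[->|yA]; first exact: addsmxSl.
  exact: submx_trans (vspan_mem yA) (addsmxSr _ _).
by rewrite addsmx_sub vspan_mem ?setU11 // vspanS ?subsetUr.
Qed.

(** Stated through the rank of the span, which avoids the row enumeration in [binary]; [vindepE]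
    shows that the two agree. *)
Definition vindep A := \rank (vspan A) == #|A|.

Lemma rank_vspanU1 x A :
  \rank (vspan (x |: A)) = (~~ (v x <= vspan A)%MS + \rank (vspan A))%N.
Proof.
rewrite (eqmxP (vspanU1 x A)); case: (boolP (v x <= vspan A)%MS) => [vxA|vxA].
  by rewrite (addsmx_idPr vxA).
apply/eqP; rewrite eqn_leq (leq_trans (mxrank_adds_leqif _ _)) /=; last first.
  by rewrite leq_add2r rank_leq_row.
by rewrite add1n rank_ltmx // /ltmx addsmxSr addsmx_sub (negPf vxA).
Qed.

Lemma rank_vspan_le A : (\rank (vspan A) <= #|A|)%N.
Proof.
have [k] := ubnP #|A|; elim: k A => // k IH A.
have [->|[x xA]] := set_0Vmem A; first by rewrite /vspan big_set0 mxrank0.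
rewrite -(setD1K xA) cardsU1 setD11 ltnS => /IH leA.
by rewrite rank_vspanU1 leq_add // leq_b1.
Qed.

Lemma vindepU1 x A : x \notin A ->
  vindep (x |: A) = vindep A && ~~ (v x <= vspan A)%MS.
Proof.
move=> xA; rewrite /vindep rank_vspanU1 cardsU1 xA; have := rank_vspan_le A.
by case: (v x <= vspan A)%MS => /= leA; rewrite ?andbT ?andbF //; apply/eqP; lia.
Qed.

Lemma vindep0 : vindep set0.
Proof. by rewrite /vindep cards0 -leqn0 -(cards0 T) rank_vspan_le. Qed.

Lemma vindep_sub A B : A \subset B -> vindep B -> vindep A.
Proof.
move=> sAB; rewrite /vindep => /eqP rB.
rewrite eqn_leq rank_vspan_le /= -(leq_add2r #|B :\: A|).
have -> : (#|A| + #|B :\: A| = #|B|)%N by rewrite -(cardsID A B) (setIidPr sAB).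
rewrite -rB; apply: leq_trans (leq_add (leqnn _) (rank_vspan_le _)).
apply: leq_trans (mxrank_adds_leqif _ _); apply: mxrankS.
apply/vspan_subP=> x xB; have [xA|xA] := boolP (x \in A).
  exact: submx_trans (vspan_mem xA) (addsmxSl _ _).
by apply: submx_trans (addsmxSr _ _); rewrite vspan_mem // inE xA.
Qed.

Lemma vindep_aug A B : vindep A -> vindep B -> (#|A| < #|B|)%N ->
  exists2 x, x \in B :\: A & vindep (x |: A).
Proof.
move=> iA /eqP rB ltAB.
case: (pickP [pred x in B | ~~ (v x <= vspan A)%MS]) => [x /andP[xB vxA]|sBA].
  have xA : x \notin A by apply: contra vxA; apply: vspan_mem.
  by exists x; rewrite ?inE ?xA // vindepU1 // iA.
have /mxrankS : (vspan B <= vspan A)%MS.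
  by apply/vspan_subP=> x xB; have := sBA x; rewrite /= xB => /negbFE.
by rewrite rB (eqP iA) leqNgt ltAB.
Qed.

Definition vector_matroid : matroid T := Matroid vindep0 vindep_sub vindep_aug.

Lemma vspan_rows m (t : 'I_m -> T) (A : {set T}) : A = [set t i | i : 'I_m] ->
  (\matrix_(i < m) v (t i) :=: vspan A)%MS.
Proof.
move=> ->; apply/eqmxP/andP; split.
  by apply/row_subP=> i; rewrite rowK vspan_mem ?imset_f.
apply/vspan_subP=> _ /imsetP[i _ ->]; apply: (eq_row_sub i); exact: rowK.
Qed.

Lemma vindepE A : vindep A = row_free (\matrix_(i < #|A|) v (@enum_val T (mem A) i)).
Proof.
rewrite /row_free (@vspan_rows _ _ A) //; apply/setP=> x; apply/idP/imsetP.
  by move=> xA; exists (enum_rank_in xA x); rewrite ?enum_rankK_in.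
by case=> i _ ->; apply: enum_valP.
Qed.

End VectorMatroid.

(** * Rank-two contractions and their points *)

Section Lines.
Variables (T : finType) (M : matroid T).
Implicit Types (Z B : {set T}) (x y : T).

(* For [#|Z|.+2 = mrank M]: [x] and [y] represent distinct points of the
   contraction [M / Z], which has rank 2 when [Z] is independent. *)
Definition apart Z x y := basis M (x |: (y |: Z)).

Definition four_point_free := forall Z a b c d, #|Z|.+2 = mrank M ->
  ~~ [&& apart Z a b, apart Z a c, apart Z a d, apart Z b c, apart Z b d & apart Z c d].

Lemma apartC Z x y : apart Z x y = apart Z y x.
Proof. by rewrite /apart setUCA. Qed.

Lemma apart_notin Z x y : #|Z|.+2 = mrank M -> apart Z x y ->
  (x \notin y |: Z) && (y \notin Z).
Proof.
move=> cZ /andP[_]; rewrite -cZ !cardsU1.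
by case: (x \notin _); case: (y \notin _) => /=; rewrite ?andbF //; lia.
Qed.

(** Parallelism is transitive on the nonloops of [M / Z], so a nonloop is parallel to at most one of
    the points [u] and [w]; [apart Z x y] makes [x] a nonloop. *)
Lemma apart_trans Z u w x y : #|Z|.+2 = mrank M ->
  apart Z u w -> apart Z x y -> apart Z x u || apart Z x w.
Proof.
move=> cZ /andP[iuw /eqP cuw]; rewrite apartC => xy.
have /andP[_ xZ] := apart_notin cZ xy; move: xy => /andP[ixy _].
have ixZ : indep M (x |: Z) by apply: indep_sub ixy; apply: subsetUr.
have cxZ : #|x |: Z|.+1 = mrank M by rewrite cardsU1 xZ add1n.
have [|z] := indep_aug ixZ iuw; first by rewrite cuw -cxZ.
case/setDP=> zuw zxZ iz.
have bz : apart Z x z by rewrite apartC /apart /basis iz cardsU1 zxZ -cxZ add1n /=.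
move: zuw zxZ; rewrite !inE negb_or => /or3P[/eqP <-|/eqP <-|->].
- by rewrite bz.
- by rewrite bz orbT.
- by rewrite andbF.
Qed.

(* The two-by-two determinant over GF(2) with rows [x], [y] and columns [b], [c]. *)
Lemma apart_det Z b c x y : four_point_free -> #|Z|.+2 = mrank M ->
  apart Z b c -> apart Z x c ->
  apart Z x y = apart Z b y (+) (apart Z b x && apart Z c y).
Proof.
move=> free4 cZ bc xc; have trans := apart_trans cZ.
have [bx|nbx] /= := boolP (apart Z b x); last first.
  rewrite addbF; apply/idP/idP=> [xy|by_].
    by have := trans _ _ _ _ xy bc; rewrite (negPf nbx).
  by have := trans _ _ _ _ by_ xc; rewrite apartC (negPf nbx).
have cx : apart Z c x by rewrite apartC.
have [by_|nby] := boolP (apart Z b y); have [cy|ncy] := boolP (apart Z c y) => /=.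
- apply/negbTE; have := free4 Z b c x y cZ.
  by rewrite bc bx by_ cx cy.
- have yb : apart Z y b by rewrite apartC.
  by have := trans _ _ _ _ cx yb; rewrite apartC (negPf ncy) apartC.
- have yc : apart Z y c by rewrite apartC.
  by have := trans _ _ _ _ bx yc; rewrite apartC (negPf nby) apartC.
- apply/negbTE/negP=> xy; rewrite apartC in xy.
  by have := trans _ _ _ _ bc xy; rewrite apartC (negPf nby) apartC (negPf ncy).
Qed.

End Lines.

(** * Fundamental circuits and basis exchange *)

Section FundamentalGraph.
Variables (T : finType).
Implicit Types (M N : matroid T) (A B : {set T}).

(** For [x] outside [B], exchanging [b] for [x] yields a basis exactly when [b] lies on the
    fundamental circuit of [x]; the third condition thus compares all fundamental circuits at
    [B]. *)
Definition same_fundamental M N B := [/\ basis M B, basis N B &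
  forall b x, b \in B -> basis M (x |: (B :\ b)) = basis N (x |: (B :\ b))].

(** A pivot: with [Z] the rest of [B] after removing [b] and [c], [apart_det] expresses each
    exchange at the new basis by exchanges at [B], in the same way for [M] and [N]. *)
Lemma same_fundamental_exchange M N B b x :
  four_point_free M -> four_point_free N -> same_fundamental M N B ->
  b \in B -> x \notin B -> basis M (x |: (B :\ b)) ->
  same_fundamental M N (x |: (B :\ b)).
Proof.
move=> fM fN [bM bN eqMN] bB xB bxM; have bxN := bxM; rewrite eqMN // in bxN.
split=> // c y; rewrite !inE => /orP[/eqP->|/andP[cb cB]].
  (* Here [c] is the element [x] just brought in, and removing it returns to [B :\ b]. *)
  by rewrite setU1K ?eqMN // !inE (negPf xB) andbF.
have cx : x != c by apply: contraNneq xB => ->.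
have bc : b != c by rewrite eq_sym.
pose Z := B :\ b :\ c.
have eBb : B :\ b = c |: Z by rewrite setD1K // !inE cb.
have eBc : B :\ c = b |: Z.
  by rewrite /Z setDDl [[set b] :|: [set c]]setUC -setDDl setD1K // !inE bc.
have eB : B = b |: (c |: Z) by rewrite -eBb setD1K.
have -> : (x |: (B :\ b)) :\ c = x |: Z.
  rewrite setDUl; congr (_ :|: _); apply/setDidPl.
  by rewrite disjoints1 inE.
have cZ (L : matroid T) : basis L B -> #|Z|.+2 = mrank L.
  case/andP=> _ /eqP <-.
  by rewrite (cardsD1 b B) bB (cardsD1 c (B :\ b)) !inE cb cB.
have exchange (L : matroid T) : four_point_free L -> basis L B ->
    basis L (x |: (B :\ b)) -> basis L (y |: (x |: Z)) =
      basis L (y |: (B :\ c)) (+)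
      (basis L (x |: (B :\ c)) && basis L (y |: (B :\ b))).
  move=> fL bL; have cL := cZ L bL; rewrite eBb eBc => xL; rewrite eB in bL.
  have := apart_det y fL cL bL xL.
  by rewrite ![apart _ _ _ y]apartC [apart _ _ b x]apartC.
by rewrite (exchange M) // (exchange N) // !eqMN.
Qed.

(** Each exchange brings an element of [A] into [B] for one outside [A], so [B :\: A] shrinks until
    [B = A], and [same_fundamental] survives every step. *)
Lemma same_fundamental_basis M N A B :
  four_point_free M -> four_point_free N -> same_fundamental M N B ->
  basis M A -> basis N A.
Proof.
move=> fM fN + bA; have [k] := ubnP #|B :\: A|; elim: k B => // k IH B ltk sB.
have [bM bN _] := sB.
have [/eqP|[b bBA]] := set_0Vmem (B :\: A).
  rewrite setD_eq0 => sBA; move: (bA) (bM) => /andP[_ /eqP cA] /andP[_ /eqP cB].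
  suff <- : B = A by [].
  by apply/eqP; rewrite eqEcard sBA cA cB leqnn.
have [x /setDP[xA xB] bx] := basis_exchange bA bM bBA.
case/setDP: bBA => bB bnA.
apply: (IH (x |: (B :\ b))); last exact: same_fundamental_exchange.
rewrite -ltnS; apply: leq_trans ltk; rewrite ltnS; apply: proper_card.
apply/properP; split; last first.
  exists b; first by rewrite !inE bnA.
  by rewrite !inE eqxx bnA /= orbF; apply: contraNneq xB => <-.
by apply/subsetP=> z; rewrite !inE => /andP[zA /orP[/eqP zx|/andP[_ ->]]];
   rewrite ?zA // -zx (negPf zA) in xA *.
Qed.

Lemma same_fundamentalC M N B : same_fundamental M N B -> same_fundamental N M B.
Proof. by case=> bM bN eqMN; split=> // b x bB; rewrite eqMN. Qed.

Lemma same_fundamental_indep M N B :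
  four_point_free M -> four_point_free N -> same_fundamental M N B ->
  indep M =1 indep N.
Proof.
move=> fM fN sB A.
by apply/indep_basisP/indep_basisP=> [] [B' sAB' bB']; exists B' => //;
   apply: same_fundamental_basis bB' => //; eauto using same_fundamentalC.
Qed.

End FundamentalGraph.

(** * Binary representability and four-point lines *)

Section Binary.
Variables (T : finType).
Implicit Types (Z A B : {set T}).
Local Open Scope ring_scope.

Lemma F2_neq0 (k : 'F_2) : k != 0 -> k = 1.
Proof. by case: k => [[|[|m]] lt_m] // _; apply: val_inj. Qed.

Lemma vector_apart n (v : T -> 'rV['F_2]_n) Z x y :
  (#|Z|.+2 = mrank (vector_matroid v))%N -> apart (vector_matroid v) Z x y ->
  ~~ (v x <= v y + vspan v Z)%MS.
Proof.
move=> cZ xy; have /andP[xyZ _] := apart_notin cZ xy.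
have /andP[ixy _] := xy; rewrite -(eqmxP (vspanU1 v y Z)).
by move: ixy; rewrite /= vindepU1 // => /andP[].
Qed.

Lemma vector_span_basis n (v : T -> 'rV['F_2]_n) B x :
  basis (vector_matroid v) B -> (v x <= vspan v B)%MS.
Proof.
move=> /andP[iB /eqP cB]; apply: contraT => vx.
have xB : x \notin B by apply: contra vx; apply: vspan_mem.
have ixB : indep (vector_matroid v) (x |: B) by rewrite /= vindepU1 // vx andbT.
by have := indep_leq_mrank ixB; rewrite cardsU1 xB -cB ltnn.
Qed.

(** The coefficients of [v x] along [v a] and [v b] are nonzero, hence 1 in GF(2): a vanishing one
    would put [v x] in the span of [Z] and the other vector. *)
Lemma vector_apart3 n (v : T -> 'rV['F_2]_n) Z a b x :
  (#|Z|.+2 = mrank (vector_matroid v))%N ->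
  apart (vector_matroid v) Z a b -> apart (vector_matroid v) Z a x ->
  apart (vector_matroid v) Z b x -> (v x - (v a + v b) <= vspan v Z)%MS.
Proof.
move=> cZ ab; rewrite apartC => xa; rewrite apartC => xb.
have := vector_span_basis x ab; rewrite (eqmxP (vspanU1 _ _ _)).
case/sub_addsmxP=> -[s1 s2] /= vx.
have : (s2 *m vspan v (b |: Z) <= v b + vspan v Z)%MS.
  by rewrite -(eqmxP (vspanU1 v b Z)) submxMl.
case/sub_addsmxP=> -[t1 t2] /= e2; rewrite {}e2 in vx.
rewrite (mx11_scalar s1) (mx11_scalar t1) !mul_scalar_mx in vx.
have s1_1 : s1 0 0 = 1.
  apply: F2_neq0; apply: contra (vector_apart cZ xb) => /eqP s0.
  by rewrite vx s0 scale0r add0r addmx_sub_adds ?scalemx_sub ?submxMl.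
have t1_1 : t1 0 0 = 1.
  apply: F2_neq0; apply: contra (vector_apart cZ xa) => /eqP t0.
  by rewrite vx t0 scale0r add0r addmx_sub_adds ?scalemx_sub ?submxMl.
by rewrite vx s1_1 t1_1 !scale1r addrA addrC addrK submxMl.
Qed.

(** Both [v c] and [v d] agree with [v a + v b] modulo the span of [Z], so [c] and [d] cannot be
    apart. *)
Lemma vector_four_point_free n (v : T -> 'rV['F_2]_n) :
  four_point_free (vector_matroid v).
Proof.
move=> Z a b c d cZ; apply/negP=> /and5P[ab ac ad bc /andP[bd cd]].
have /negP := vector_apart cZ cd; apply.
have -> : v c = v d + ((v c - (v a + v b)) - (v d - (v a + v b))).
  by rewrite opprB subrKA addrC subrK.
rewrite addmx_sub_adds // addmx_sub ?eqmx_opp //; exact: vector_apart3.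
Qed.

Lemma binary_vector_matroid (M : matroid T) : binary M ->
  exists n (v : T -> 'rV['F_2]_n), indep M =1 indep (vector_matroid v).
Proof. by case=> n [v iM]; exists n, v => A; rewrite iM /= vindepE. Qed.

Lemma four_point_free_binary (M : matroid T) : four_point_free M -> binary M.
Proof.
move=> free4; have [B bB] := basis_exists M; have /andP[iB /eqP cB] := bB.
pose e (i : 'I_#|B|) : T := enum_val i.
(* Incidence vector of the fundamental circuit of [x]: coordinate [i] is 1 exactly when [x] can
   replace [e i] in [B]. *)
pose v x : 'rV['F_2]_#|B| := \row_i (basis M (x |: (B :\ e i)))%:R.
have eB i : e i \in B by apply: enum_valP.
have Dcard b x : b \in B -> x \in B :\ b -> (#|x |: (B :\ b)| < #|B|)%N.
  by move=> bB' xBb; rewrite setUC (setUidPl _) ?sub1set // [ltnRHS](cardsD1 b) bB'.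
have ve i : v (e i) = delta_mx 0 i.
  apply/rowP=> j; rewrite !mxE eqxx /=; case: eqVneq => [->|ji].
    by rewrite setD1K ?bB.
  rewrite /basis (_ : _ == _ = false) ?andbF // -cB ltn_eqF // Dcard //.
  by rewrite !inE eB (inj_eq enum_val_inj) eq_sym ji.
have fullB : (vspan v B :=: 1%:M)%MS.
  apply: eqmx_trans (_ : (\matrix_i v (e i) :=: 1%:M)%MS).
    apply/eqmx_sym/vspan_rows/setP=> x; apply/idP/imsetP=> [xB|[i _ ->]] //.
    by exists (enum_rank_in xB x); rewrite // /e enum_rankK_in.
  have -> : \matrix_i v (e i) = 1%:M; last by [].
  by apply/row_matrixP=> i; rewrite rowK ve row1.
pose N := vector_matroid v.
have bN : basis N B.
  have iN : vindep v B by rewrite /vindep fullB mxrank1.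
  rewrite /basis [indep N B]iN eqn_leq (indep_leq_mrank (M := N)) //=.
  by apply/bigmax_leqP=> A /eqP <-; apply: rank_leq_col.
have same : same_fundamental M N B.
  split=> // b x bB'; have [i eb] : exists i, b = e i.
    by exists (enum_rank_in bB' b); rewrite /e enum_rankK_in.
  have [xBb|xBb] := boolP (x \in B :\ b).
    have ltB := Dcard b x bB' xBb; have /andP[_ /eqP cN] := bN.
    by rewrite /basis -cB -cN ltn_eqF // !andbF.
  have cxB : #|x |: (B :\ b)| = #|B| by rewrite cardsU1 xBb [RHS](cardsD1 b) bB'.
  have /andP[iN /eqP cN] := bN.
  rewrite [RHS]/basis cxB cN eqxx andbT [indep N _]vindepU1 //.
  rewrite [vindep _ _](vindep_sub (subsetDl B [set b]) iN) /=.
  (* In the vector matroid the exchange means that [v x] is outside the span of the other vectors of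
     [B]. As these are unit vectors, this says that coordinate [i] of [v x] is nonzero. *)
  have -> : basis M (x |: (B :\ b)) = (v x 0 i != 0).
    by rewrite mxE -eb; case: (basis M _).
  congr (~~ _); apply/eqP/idP=> [vx0|vxB].
    rewrite [v x]row_sum_delta summx_sub // => j _; have [->|ji] := eqVneq j i.
      by rewrite vx0 scale0r sub0mx.
    by rewrite scalemx_sub // -ve vspan_mem // !inE eB eb (inj_eq enum_val_inj) ji.
  have /(submx_trans vxB)/sub_kermxP :
      (vspan v (B :\ b) <= kermx (delta_mx i 0 : 'cV_#|B|))%MS.
    apply/vspan_subP=> y; rewrite !inE => /andP[yb yB]; apply/sub_kermxP.
    have [j ey] : exists j, y = e j.
      by exists (enum_rank_in yB y); rewrite /e enum_rankK_in.
    rewrite ey ve mul_delta_mx_0 //; apply: contraNneq yb => ji.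
    by rewrite ey ji eb.
  by rewrite -colE => /matrixP/(_ 0 0); rewrite !mxE.
exists #|B|, v => A; rewrite -vindepE.
exact: (same_fundamental_indep free4 (@vector_four_point_free _ v) same).
Qed.

End Binary.

(** * Colorings along a flag of flats *)

Section FlagColoring.
Variables (T : finType) (M : matroid T).
Implicit Types (Z I J X D : {set T}).

Lemma spansS I J x : I \subset J -> spans M I x -> spans M J x.
Proof.
move=> sIJ /orP[xI|dI]; apply/orP; [left|right]; first exact: (subsetP sIJ).
by apply: contra dI; apply: indep_sub; apply: setUS.
Qed.

Lemma apart_spans Z x y : #|Z|.+2 = mrank M -> apart M Z x y -> ~~ spans M (y |: Z) x.
Proof.
move=> cZ xy; have /andP[xyZ _] := apart_notin cZ xy.
by rewrite /spans negb_or xyZ negbK; case/andP: xy.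
Qed.

(** Minimality of [D] yields a basis [B] of [X] meeting [D] only in [q]. Were [X :\: D] spanned by
    [Z], [indep_add2] would allow adding [p] to [B], against maximality. *)
Lemma cut_spans Z X D p q : #|Z|.+2 = mrank M -> apart M Z p q ->
  cut_in M X D -> p \in D -> q \in D -> ~ {in X :\: D, forall x, spans M Z x}.
Proof.
move=> cZ pq /minsetP[/andP[sDX /forallP hitD] minD] pD qD sZ.
have /andP[ipq /eqP cpq] := pq; have /andP[pqZ _] := apart_notin cZ pq.
have : ~~ [forall B, basis_in M X B ==> ((D :\ q) :&: B != set0)].
  apply/negP=> hitDq; have : D :\ q = D.
    apply: minD; last exact: subsetDl.
    by rewrite hitDq andbT (subset_trans (subsetDl _ _)).
  by move/setP/(_ q); rewrite !inE eqxx qD.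
case/forallPn=> B; rewrite negb_imply negbK => /andP[bB /eqP DqB].
have := hitD B; rewrite bB /= => /set0Pn[x /setIP[xD xB]].
have xq : x = q.
  apply/eqP; apply: contraT => xq; have : x \in (D :\ q) :&: B by rewrite !inE xq xD.
  by rewrite DqB inE.
move: xB; rewrite {}xq => qB; have [/andP[sBX iB] maxB] := maxsetP bB.
have pNq : p != q by apply: contraNneq pqZ => ->; rewrite setU11.
have : indep M (p |: (q |: (B :\ q))).
  apply: indep_add2 ipq _ _ _; first by rewrite cpq.
    by apply: indep_sub iB; apply: subsetDl.
  move=> y; rewrite !inE => /andP[yq yB]; apply: sZ; rewrite inE (subsetP sBX) //.
  rewrite andbT; apply/negP=> yD.
  have : y \in (D :\ q) :&: B by rewrite !inE yq yD.
  by rewrite DqB inE.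
rewrite setD1K // => ipB; have := maxB (p |: B); rewrite ipB subUset sBX.
rewrite sub1set (subsetP sDX) //= subsetUr => /(_ isT isT) eB.
have : p \in (D :\ q) :&: B by rewrite !inE pNq pD -eB setU11.
by rewrite DqB inE.
Qed.

Hypothesis loopfree : loopless M.
Variables (Z : {set T}) (a b : T).
Let k := #|Z|.

Definition initial j : {set T} := [set z in take j (enum Z)].

(** The value is [k.+1] when no initial segment spans [x]; as [initial k] is [Z], [level x <= k]
    says that [Z] spans [x]. *)
Definition level x := find (fun j => spans M (initial j) x) (iota 0 k.+1).

(* Elements spanned by [Z] are colored along the flag of the flats spanned by
   the sets [initial j]; the elements outside are split into two classes, the
   first one consisting of the two points [a] and [b] of [M / Z]. *)
Definition flag_color x :=
  if level x <= k then level x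
  else if spans M (a |: Z) x || spans M (b |: Z) x then k.+1 else k.+2.

(** The shift by one skips color 0, which looplessness excludes: the empty set spans only loops. *)
Definition flag_class (i : 'I_k.+2) := [set x | flag_color x == i.+1].

Definition flag_coloring := [set flag_class i | i : 'I_k.+2].

Lemma initial0 : initial 0 = set0.
Proof. by apply/setP=> x; rewrite !inE take0. Qed.

Lemma initialS i j : i <= j -> initial i \subset initial j.
Proof.
move=> le_ij; apply/subsetP=> x; rewrite !inE => xi.
by rewrite -(subnKC le_ij) takeD mem_cat xi.
Qed.

Lemma initial_sub j : initial j \subset Z.
Proof. by apply/subsetP=> x; rewrite !inE => /mem_take; rewrite mem_enum. Qed.

Lemma level_le x : level x <= k.+1.
Proof.
by rewrite -[k.+1 in leqRHS](size_iota 0); apply: find_size.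
Qed.

Lemma level_spans x : level x <= k -> spans M (initial (level x)) x.
Proof.
move=> lx; have := @nth_find _ 0 (fun j => spans M (initial j) x) (iota 0 k.+1).
rewrite has_find size_iota -/(level x) nth_iota //; exact.
Qed.

Lemma level_before x j : j < level x -> ~~ spans M (initial j) x.
Proof.
move=> lt_j; have := @before_find _ 0 (fun j => spans M (initial j) x) (iota 0 k.+1) j lt_j.
by rewrite nth_iota ?add0n => [->|] //; apply: leq_trans lt_j (level_le x).
Qed.

Lemma level_gt0 x : 0 < level x.
Proof.
rewrite lt0n; apply/negP=> /eqP l0; have := @level_spans x; rewrite l0 => /(_ isT).
by rewrite initial0 /spans inE setU0 loopfree.
Qed.

Lemma level_out x : ~~ spans M Z x -> level x = k.+1.
Proof.
move=> nx; apply/eqP; rewrite eqn_leq level_le ltnNge; apply: contra nx.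
by move/level_spans; apply: spansS; apply: initial_sub.
Qed.

Lemma flag_colorE x : ~~ spans M Z x ->
  flag_color x = if spans M (a |: Z) x || spans M (b |: Z) x then k.+1 else k.+2.
Proof. by move=> /level_out; rewrite /flag_color => ->; rewrite ltnn. Qed.

Lemma flag_color_gt0 x : 0 < flag_color x.
Proof. by rewrite /flag_color; case: ifP => _; [apply: level_gt0 | case: ifP]. Qed.

Lemma flag_color_le x : flag_color x <= k.+2.
Proof. by rewrite /flag_color; case: ifP => lx; [lia | case: ifP]. Qed.

Lemma flag_color_leS x : flag_color x <= k.+1 -> flag_color x = level x.
Proof.
rewrite /flag_color; case: ifP => // /negbT lx; case: ifP => [_ _|]; last by rewrite ltnn.
by have := level_le x; lia.
Qed.

Lemma flag_color_eqS x : flag_color x = k.+1 ->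
  spans M (a |: Z) x || spans M (b |: Z) x.
Proof.
rewrite /flag_color; move: (level x) => l; case: leqP => [lek ek|_].
  by rewrite ek ltnn in lek.
by case: (_ || _) => // -[/eqP]; rewrite eqn_leq ltnn.
Qed.

Lemma flag_color_eqSS x : flag_color x = k.+2 ->
  ~~ (spans M (a |: Z) x || spans M (b |: Z) x).
Proof.
rewrite /flag_color; move: (level x) => l; case: leqP => [lek ek|_].
  by rewrite ek ltnNge leqnSn in lek.
by case: (_ || _) => // -[/eqP]; rewrite eqn_leq ltnn andbF.
Qed.

Definition flag_index x : 'I_k.+2 := inord (flag_color x).-1.

Lemma flag_indexK x : (flag_index x).+1 = flag_color x.
Proof.
by rewrite inordK prednK ?flag_color_gt0 ?flag_color_le.
Qed.

Lemma mem_flag_class x i : (x \in flag_class i) = (flag_index x == i).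
Proof. by rewrite inE -flag_indexK eqSS. Qed.

Lemma flag_rainbow C x y : rainbow flag_coloring C -> x \in C -> y \in C ->
  flag_color x = flag_color y -> x = y.
Proof.
move=> /forall_inP rC xC yC exy.
have /rC/card_le1_eqP : flag_class (flag_index x) \in flag_coloring by apply: imset_f.
by apply; rewrite in_setI ?xC ?yC mem_flag_class /flag_index exy eqxx.
Qed.

Hypothesis indepZ : indep M Z.
Hypotheses (iaZ : indep M (a |: Z)) (ibZ : indep M (b |: Z)).

(** In a rainbow circuit, the elements other than the one of largest color are spanned by an
    independent set that, by the choice of colors, does not span that one; this contradicts
    [circuit_spans]. *)
Lemma flag_rainbow_circuit_free : rainbow_circuit_free M flag_coloring.
Proof.
apply/forallP=> C; apply/implyP=> cC; apply/negP=> rC.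
have [x0 x0C] : exists x, x \in C.
  apply/set0Pn; apply: contraTneq cC => ->.
  by rewrite /circuit indep0.
have [x xC xmax] := arg_maxnP flag_color x0C.
have ltx y : y \in C :\ x -> flag_color y < flag_color x.
  case/setD1P=> yx yC; rewrite ltn_neqAle (_ : _ <= _) ?andbT; last exact: xmax.
  by apply: contra yx => /eqP/(flag_rainbow rC yC xC)->.
have iI j : indep M (initial j) by apply: indep_sub indepZ; apply: initial_sub.
have [lex|gtx] := leqP (flag_color x) k.+1.
  have ex := flag_color_leS lex; have lx := level_gt0 x.
  (* All other elements of [C] have smaller level, so the initial segment just below the level of
     [x] would already span [x]. *)
  have /negP := @level_before x (level x).-1 ltac:(by rewrite prednK); apply.
  apply: circuit_spans cC xC _ => // y yC; have lty := ltx y yC.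
  have ey : flag_color y = level y by apply: flag_color_leS; lia.
  apply: spansS (initialS _) (level_spans _); first by lia.
  by have := level_le x; lia.
have ex : flag_color x = k.+2 by have := flag_color_le x; lia.
have nx : ~~ (spans M (a |: Z) x || spans M (b |: Z) x).
  by move: ex => /flag_color_eqSS.
have lowy y : flag_color y <= k -> spans M Z y.
  move=> ley; have ey := flag_color_leS (leqW ley).
  by apply: spansS (initial_sub _) (level_spans _); rewrite -ey.
(* At most one element of [C] has color [k.+1]; [e] is whichever of [a] and [b] spans it together
   with [Z], and [a] if there is none. *)
have [e [eab ie hy]] : exists e,
    [/\ spans M (e |: Z) x -> spans M (a |: Z) x || spans M (b |: Z) x,
    indep M (e |: Z) & forall y, y \in C :\ x -> flag_color y = k.+1 -> spans M (e |: Z) y].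
  have [y /andP[yC /eqP ey]|none] := pickP [pred y in C | flag_color y == k.+1]; last first.
    exists a; split=> // [->|y /setD1P[_ yC] ey] //.
    by have := none y; rewrite /= yC ey eqxx.
  have uniq_y z : z \in C :\ x -> flag_color z = k.+1 -> z = y.
    by case/setD1P=> _ zC ez; apply: flag_rainbow rC zC yC _; rewrite ez ey.
  have := flag_color_eqS ey.
  by case/orP=> sy; [exists a | exists b]; split=> // [->|z zC /(uniq_y z zC)->];
    rewrite ?orbT.
case/negP: nx; apply: eab; apply: circuit_spans cC xC _ => // y yC.
have := ltx y yC; rewrite ex ltnS leq_eqVlt => /orP[/eqP/(hy y yC) //|].
by rewrite ltnS => /lowy; apply: spansS; apply: subsetUr.
Qed.

Lemma flag_coloringP : (forall i, exists x, flag_index x = i) ->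
  coloring flag_coloring /\ #|flag_coloring| = k.+2.
Proof.
move=> onto; split; last first.
  rewrite card_imset ?card_ord // => i j /setP eij; have [x xi] := onto i.
  by have := eij x; rewrite !mem_flag_class xi eqxx => /esym/eqP.
apply/and3P; split.
- apply/eqP/setP=> x; rewrite in_setT; apply/bigcupP.
  by exists (flag_class (flag_index x)); rewrite ?imset_f ?mem_flag_class.
- apply/trivIsetP=> _ _ /imsetP[i _ ->] /imsetP[j _ ->] ij.
  rewrite -setI_eq0; apply: contraNT ij => /set0Pn[x]; rewrite in_setI !mem_flag_class.
  by case/andP=> /eqP-> /eqP->.
- apply/negP=> /imsetP[i _ /setP e0]; have [x xi] := onto i.
  by have := e0 x; rewrite mem_flag_class xi eqxx inE.
Qed.

(** Shows that the colors 1 to [k] are all taken, by elements of [Z]. *)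
Lemma level_nth (x0 : T) i : i < k -> level (nth x0 (enum Z) i) = i.+1.
Proof.
move=> ltik; set z := nth _ _ _.
have szZ : size (enum Z) = k by rewrite -cardE.
have zZ : z \in Z by rewrite -mem_enum mem_nth ?szZ.
apply/eqP; rewrite eqn_leq; apply/andP; split.
  rewrite leqNgt; apply/negP=> /level_before/negP; apply; apply/orP; left.
  by rewrite inE /z -(nth_take x0 (ltnSn i)) mem_nth // size_takel ?szZ.
rewrite ltnNge; apply/negP=> lei.
have := level_spans (leq_trans lei (ltnW ltik)).
case/orP=> [|/negP]; last first.
  by apply; apply: indep_sub indepZ; rewrite subUset sub1set zZ initial_sub.
move/(subsetP (initialS lei)); rewrite inE in_take ?mem_enum //.
by rewrite index_uniq ?enum_uniq ?szZ // ltnn.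
Qed.

End FlagColoring.

(** The last two flag colors contain [a], [b] and [c], [d] respectively. In a standard order,
    whichever of these two classes comes first is preceded only by elements spanned by [Z], so
    [cut_spans] shows that it is no cut. *)
Lemma standard_four_point_free (T : finType) (M : matroid T) : loopless M ->
  (forall P : {set {set T}},
     coloring P -> #|P| = mrank M -> rainbow_circuit_free M P -> standard M P) ->
  four_point_free M.
Proof.
move=> loopM stdM Z a b c d cZ; apply/negP=> /and5P[ab ac ad bc /andP[bd cd]].
have sub_apart x y : apart M Z x y -> indep M (y |: Z).
  by case/andP=> ixy _; apply: indep_sub ixy; apply: subsetUr.
have out_apart x y : apart M Z x y -> ~~ spans M Z x.
  by move/(apart_spans cZ); apply: contra; apply: spansS; apply: subsetUr.
have ba : apart M Z b a by rewrite apartC.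
have iaZ := sub_apart _ _ ba; have ibZ := sub_apart _ _ ab.
have iZ : indep M Z by apply: indep_sub iaZ; apply: subsetUr.
have ca : apart M Z c a by rewrite apartC.
have cb : apart M Z c b by rewrite apartC.
have da : apart M Z d a by rewrite apartC.
have db : apart M Z d b by rewrite apartC.
pose col := flag_color M Z a b.
have colc x : apart M Z x a -> apart M Z x b -> col x = #|Z|.+2.
  move=> xa xb; rewrite /col flag_colorE ?(out_apart _ _ xa) //.
  by rewrite (negPf (apart_spans cZ xa)) (negPf (apart_spans cZ xb)).
have colaE : col a = #|Z|.+1.
  by rewrite /col flag_colorE ?(out_apart _ _ ab) // /spans setU11.
have colbE : col b = #|Z|.+1.
  by rewrite /col flag_colorE ?(out_apart _ _ ba) // /spans setU11 orbT.
have colcE := colc c ca cb; have coldE := colc d da db.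
pose cl := @flag_class _ M Z a b.
have onto i : exists x, flag_index M Z a b x = i.
  suff [x ex] : exists x, col x = i.+1.
    by exists x; apply: val_inj; apply: succn_inj; rewrite flag_indexK.
  have [ltik|] := ltnP i #|Z|.
    exists (nth a (enum Z) i); have := level_nth iZ a ltik => el.
    by rewrite /col /flag_color el ltik.
  rewrite leq_eqVlt => /orP[/eqP <-|gti]; first by exists a.
  by exists c; rewrite colcE; congr _.+1; apply/eqP; rewrite eqn_leq gti -ltnS ltn_ord.
have [colP cardP] := flag_coloringP loopM onto.
have [|S [injS PS cutS]] := stdM _ colP _ (flag_rainbow_circuit_free loopM iZ iaZ ibZ).
  by rewrite cardP.
have ex_class i : exists j, S j = cl i.
  have : cl i \in flag_coloring M Z a b by apply: imset_f.
  by rewrite PS => /imsetP[j _ ->]; exists j.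
(* [inord #|Z|] and [ord_max] index the classes of colors [#|Z|.+1] and [#|Z|.+2]. *)
have no_cut i p q : apart M Z p q -> p \in S i -> q \in S i ->
    (forall j : 'I_(mrank M), j < i -> S j != cl (inord #|Z|) /\ S j != cl ord_max) -> False.
  move=> pq pS qS before; apply: cut_spans cZ pq (cutS i) pS qS _ => x.
  case/setDP=> /bigcupP[j le_ji xj] xi.
  have ltji : j < i.
    by rewrite ltn_neqAle le_ji andbT; apply: contraNneq xi => /val_inj <-.
  have [nA nB] := before j ltji.
  have : S j \in flag_coloring M Z a b by rewrite PS imset_f.
  case/imsetP=> m _ eSj; rewrite eSj in nA nB xj.
  move: xj; rewrite inE -/(col x) => /eqP colx.
  apply: contraT => nx; have := flag_colorE a b nx; rewrite -/(col x) colx.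
  case: ifP => _ [em]; [case/eqP: nA | case/eqP: nB]; congr (cl _); apply: val_inj => //=.
  by rewrite inordK.
have [iA SA] := ex_class (inord #|Z|); have [iB SB] := ex_class ord_max.
have memA x : (x \in S iA) = (col x == #|Z|.+1) by rewrite SA inE inordK.
have memB x : (x \in S iB) = (col x == #|Z|.+2) by rewrite SB inE.
have [ltAB|ltBA|/val_inj eAB] := ltngtP iA iB.
- apply: (no_cut iA a b) => //; rewrite ?memA ?colaE ?colbE // => j ltj.
  rewrite -SA -SB !(inj_eq injS) !neq_ltn ltj; split=> //.
  by rewrite (ltn_trans ltj ltAB).
- apply: (no_cut iB c d) => //; rewrite ?memB ?colcE ?coldE // => j ltj.
  rewrite -SA -SB !(inj_eq injS) !neq_ltn ltj; split=> //.
  by rewrite (ltn_trans ltj ltBA).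
- by have := memA a; rewrite eAB memB colaE !eqn_leq ltnn andbF leqnn.
Qed.

(** * Ordering a digraph by successive sinks *)

Section SinkOrder.
Variables (I : finType) (e : rel I).
Implicit Types J : {set I}.

Definition has_sink J := exists2 i, i \in J & forall j, j \in J -> j != i -> ~~ e i j.

(** Each listed element is a sink of what remains, so no edge leads to a later one. *)
Lemma sink_order : (forall J, J != set0 -> has_sink J) ->
  exists p : 'I_#|I| -> I, injective p /\ forall i j : 'I_#|I|, i < j -> ~~ e (p i) (p j).
Proof.
move=> sinks.
have order J : exists s : seq I, [/\ uniq s, s =i J & pairwise (fun i j => ~~ e i j) s].
  have [k] := ubnP #|J|; elim: k J => // k IH J leJ.
  have [->|J0] := eqVneq J set0; first by exists [::]; split=> // i; rewrite inE.
  have [i iJ sink_i] := sinks J J0.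
  have [|s [us sJ ps]] := IH (J :\ i); first by move: leJ; rewrite (cardsD1 i J) iJ; lia.
  exists (i :: s); split=> /= [|j|].
  - by rewrite us sJ !inE eqxx.
  - by rewrite inE sJ !inE; case: eqVneq => // ->.
  - rewrite ps andbT; apply/allP=> j; rewrite sJ => /setD1P[ji jJ].
    exact: sink_i.
have [s [us sT ps]] := order setT.
have ss : size s == #|I|.
  by rewrite -(card_uniqP us) (eq_card sT) cardsT.
pose t := Tuple ss; exists (tnth t); split=> [i j|i j ltij].
  have x0 := tnth t i; rewrite !(tnth_nth x0) => /eqP.
  by rewrite nth_uniq ?(eqP ss) // => /eqP/val_inj.
have x0 := tnth t i; rewrite !(tnth_nth x0).
by apply: (pairwiseP x0 ps) ltij; rewrite inE (eqP ss).
Qed.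

End SinkOrder.

(** * Coordinates with respect to a transversal *)

Section DualTransversals.
Variables (T : finType) (r : nat) (S : 'I_r -> {set T}) (b : 'I_r -> T).
Variable w : T -> 'rV['F_2]_r.
Local Open Scope ring_scope.
Hypothesis bS : forall i, b i \in S i.
Hypothesis wb : forall i, w (b i) = delta_mx 0 i.
(** Nonsingularity of all transversals, in a form where the transversal may be chosen after the
    column [phi]. *)
Hypothesis nonsingular : forall phi : 'cV['F_2]_r,
  (forall i, exists2 x, x \in S i & w x *m phi = 0) -> phi = 0.

(** If the coordinate vanished, replacing [b i] by [x] in the transversal [b] would give one whose
    coordinate [i] is zero throughout. *)
Lemma coord_diag i x : x \in S i -> w x 0 i = 1.
Proof.
move=> xS; apply: F2_neq0; apply/eqP=> wx0.
suff /matrixP/(_ i 0) : delta_mx i 0 = 0 :> 'cV['F_2]_r by rewrite !mxE !eqxx.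
apply: nonsingular => j; have [->|ji] := eqVneq j i.
  by exists x => //; rewrite -colE; apply/matrixP=> ? ?; rewrite !mxE !ord1.
by exists (b j); rewrite // wb mul_delta_mx_0.
Qed.

Definition color_edge i j := [exists x in S i, w x 0 j != 0].

Lemma color_edgeN i j x : ~~ color_edge i j -> x \in S i -> w x 0 j = 0.
Proof. by move=> /exists_inPn ne /ne; rewrite negbK => /eqP. Qed.

(* In a nonempty set [J] of colors without sink of minimal size, let [s k] be a
   sink of [J :\ k]: its only out-neighbour in [J] is [k], so [s] is injective
   on [J], hence onto. Every color of [J] thus has an element with exactly two
   nonzero coordinates in [J], and the sum of the coordinates in [J] vanishes
   on a transversal. *)
Lemma color_sink (J : {set 'I_r}) : J != set0 -> has_sink color_edge J.
Proof.
have [m] := ubnP #|J|; elim: m J => // m IH J leJ /set0Pn[i0 i0J].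
case: (pickP [pred i in J | [forall (j | j \in J), (j != i) ==> ~~ color_edge i j]]).
  by move=> i /andP[iJ /forall_inP sink_i]; exists i => // j /sink_i/implyP.
move=> no_sink.
have out i : i \in J -> exists2 j, j \in J :\ i & color_edge i j.
  move=> iJ; have := no_sink i; rewrite /= iJ => /negbT/forall_inPn[j jJ].
  by rewrite negb_imply negbK => /andP[ji eij]; exists j; rewrite // !inE ji.
have /fin_all_exists[s sP] : forall k, exists i, k \in J ->
    i \in J :\ k /\ forall j, j \in J :\ i -> color_edge i j -> j = k.
  move=> k; have [kJ|] := boolP (k \in J); last by exists k.
  have [j jJk _] := out k kJ.
  have [||i iJk sink_i] := IH (J :\ k).
  - by move: leJ; rewrite (cardsD1 k J) kJ; lia.
  - by apply/set0Pn; exists j.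
  exists i => _; split=> // l /setD1P[li lJ] eil; apply/eqP; apply: contraT => lk.
  by have /negP := sink_i l ltac:(by rewrite !inE lk) li; case.
have sJ k : k \in J -> s k \in J by move=> /sP[/setD1P[]].
have inj_s : {in J &, injective s}.
  move=> k k' kJ k'J eqs; have [j jJ ej] := out _ (sJ k kJ).
  have [_ /(_ j jJ ej) <-] := sP k kJ.
  by rewrite eqs in jJ ej; have [_ /(_ j jJ ej) <-] := sP k' k'J.
have onto i : i \in J -> exists2 k, k \in J & i = s k.
  move=> iJ; apply/imsetP; suff -> : s @: J = J by [].
  apply/eqP; rewrite eqEcard card_in_imset // leqnn andbT.
  by apply/subsetP=> _ /imsetP[k kJ ->]; apply: sJ.
pose phi : 'cV['F_2]_r := \col_j (j \in J)%:R.
have phiE x : w x *m phi = (\sum_(j in J) w x 0 j)%:M.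
  apply/matrixP=> i j; rewrite !mxE !ord1 eqxx mulr1n [RHS]big_mkcond.
  by apply: eq_bigr => l _; rewrite mxE; case: (l \in J); rewrite ?mulr1 ?mulr0.
suff /matrixP/(_ i0 0) : phi = 0 by rewrite !mxE i0J.
apply: nonsingular => i; have [iJ|iJ] := boolP (i \in J); last first.
  exists (b i); rewrite // phiE wb big1 ?raddf0 // => j jJ.
  by rewrite mxE eqxx /=; case: eqVneq jJ iJ => // -> ->.
have [k kJ ei] := onto i iJ; have [/setD1P[ski _] only_k] := sP k kJ.
rewrite -ei in ski only_k.
have [j jJ eij] := out i iJ; have ejk := only_k j jJ eij; rewrite {j}ejk in jJ eij.
have /exists_inP[x xS /F2_neq0 xk] := eij; exists x => //.
rewrite phiE (bigD1 i) //= (coord_diag xS) (bigD1 k) /= ?xk ?kJ 1?eq_sym //.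
rewrite big1 ?addr0 => [|j /andP[/andP[jnJ ji] jk]].
  by apply/matrixP=> ? ?; rewrite !ord1; apply/val_inj; rewrite !mxE.
apply: color_edgeN xS; apply/negP=> e_ij; case/eqP: jk.
by apply: only_k; rewrite // !inE ji.
Qed.

End DualTransversals.

(** * Rainbow circuit-free colorings of binary matroids *)

Section StandardColoring.
Variables (T : finType) (M : matroid T).
Local Open Scope ring_scope.

(** A circuit inside a transversal has at most one element in each class, so it would be rainbow. *)
Lemma transversal_indep (P : {set {set T}}) (I : finType) (S : I -> {set T}) (t : I -> T) :
  coloring P -> rainbow_circuit_free M P -> (forall i, S i \in P) -> injective S ->
  (forall i, t i \in S i) -> injective t /\ indep M [set t i | i : I].
Proof.
move=> /and3P[_ /trivIsetP trivP _] /forallP rcf SP injS tS.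
have tE i j : t i \in S j -> i = j.
  move=> tij; apply: injS; apply/eqP; apply: contraT => /(trivP _ _ (SP i) (SP j)).
  by move/pred0P/(_ (t i)); rewrite /= tS tij.
split=> [i j eqt|]; first by apply: tE; rewrite eqt.
apply: contraT => /circuit_exists[C sCt cC].
have := rcf C; rewrite cC /= => /forall_inPn[X XP]; rewrite -ltnNge => /card_gt1P[x [y]].
case=> /setIP[/(subsetP sCt)/imsetP[i _ ->] xX] /setIP[/(subsetP sCt)/imsetP[j _ ->] yX].
have SE k : t k \in X -> S k = X.
  move=> tkX; apply/eqP; apply: contraT => /(trivP _ _ (SP k) XP).
  by move/pred0P/(_ (t k)); rewrite /= tS tkX.
by rewrite (injS i j) ?eqxx // (SE i xX) (SE j yX).
Qed.

Lemma binary_standard (P : {set {set T}}) : binary M ->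
  coloring P -> #|P| = mrank M -> rainbow_circuit_free M P -> standard M P.
Proof.
move=> /binary_vector_matroid[n [v iM]] colP cardP rcf.
pose S (i : 'I_(mrank M)) : {set T} := enum_val (cast_ord (esym cardP) i).
have SP i : S i \in P by apply: enum_valP.
have injS : injective S by move=> i j /enum_val_inj/cast_ord_inj.
have ontoS X : X \in P -> exists i, X = S i.
  move=> XP; exists (cast_ord cardP (enum_rank_in XP X)).
  by rewrite /S cast_ordK enum_rankK_in.
have /and3P[_ /trivIsetP trivP PN0] := colP.
have S_inj i j x : x \in S i -> x \in S j -> i = j.
  move=> xi xj; apply: injS; apply/eqP; apply: contraT => /(trivP _ _ (SP i) (SP j)).
  by move/pred0P/(_ x); rewrite /= xi xj.
have /fin_all_exists[b bS] i : exists x, x \in S i.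
  by apply/set0Pn; apply: contraNneq PN0 => <-.
have trans t := transversal_indep colP rcf SP injS (t := t).
have rowsE (t : 'I_(mrank M) -> T) : (forall i, t i \in S i) ->
    row_free (\matrix_i v (t i)).
  move=> tS; have [injt it] := trans t tS.
  rewrite /row_free (vspan_rows v (erefl [set t i | i : _])).
  by move: it; rewrite iM => /eqP->; rewrite card_imset // card_ord.
pose Q := \matrix_i v (b i); have freeQ : row_free Q := rowsE b bS.
(* The transversal [b] is independent with [mrank M] elements, so adding an [x] outside its span
   would exceed the rank. *)
have vQ x : (v x <= Q)%MS.
  rewrite (vspan_rows v (erefl [set b i | i : _])).
  have [injb ib] := trans b bS.
  have [xb|xb] := boolP (x \in [set b i | i : _]); first exact: vspan_mem.
  apply: contraT => vx; have : indep M (x |: [set b i | i : _]).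
    by rewrite iM /= vindepU1 // vx andbT; rewrite iM in ib.
  by move/indep_leq_mrank; rewrite cardsU1 xb card_imset // card_ord ltnn.
(* The coordinates of [v x] in the basis formed by the rows of [Q]. *)
pose w x : 'rV_(mrank M) := v x *m pinvmx Q.
have wQ x : w x *m Q = v x by rewrite mulmxKpV.
have wb i : w (b i) = delta_mx 0 i.
  by apply: (row_free_inj freeQ); rewrite /= wQ -rowE rowK.
have nonsingular (phi : 'cV['F_2]_(mrank M)) :
    (forall i, exists2 x, x \in S i & w x *m phi = 0) -> phi = 0.
  case/fin_all_exists2=> t tS tphi; pose W := \matrix_i w (t i).
  have WQ : W *m Q = \matrix_i v (t i).
    by apply/row_matrixP=> i; rewrite row_mul !rowK wQ.
  have unitW : W \in unitmx.
    rewrite -row_free_unit /row_free eqn_leq rank_leq_row /=.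
    by rewrite -{1}(eqP (rowsE t tS)) -WQ mxrankM_maxl.
  rewrite -[phi](mulKmx unitW); suff -> : W *m phi = 0 by rewrite mulmx0.
  by apply/row_matrixP=> i; rewrite row_mul rowK tphi row0.
have wdiag := coord_diag bS wb nonsingular.
have := sink_order (color_sink bS wb nonsingular); rewrite card_ord.
case=> p [injp noedge].
have [p' p'K pK] := injF_bij injp.
exists (S \o p); split.
- exact: inj_comp.
- apply/setP=> X; apply/idP/imsetP=> [/ontoS[i ->]|[i _ ->]]; last exact: SP.
  by exists (p' i); rewrite //= pK.
move=> i; set X := \bigcup_(j : 'I_(mrank M) | _) _.
have XP x : x \in X -> exists2 j : 'I_(mrank M), (j <= i)%N & x \in S (p j).
  by case/bigcupP=> j le_ji xj; exists j.
have SX (j : 'I_(mrank M)) : (j <= i)%N -> S (p j) \subset X.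
  by move=> le_ji; apply: (bigcup_sup j).
(* The sink order makes the coordinates triangular. *)
have later (j l : 'I_(mrank M)) x : x \in S (p j) -> (j < l)%N -> w x 0 (p l) = 0.
  by move=> xj /noedge/color_edgeN; apply.
have vspan_coord (A : {set T}) x l : {in A, forall y, w y 0 l = 0} ->
    (v x <= vspan v A)%MS -> w x 0 l = 0.
  pose U := pinvmx Q *m (delta_mx l 0 : 'cV_(mrank M)) => A0 xA.
  have vU y : v y *m U = (w y 0 l)%:M.
    rewrite mulmxA -/(w y) -colE; apply/matrixP=> k m.
    by rewrite !ord1 mxE [RHS]mxE eqxx mulr1n.
  have /(submx_trans xA)/sub_kermxP : (vspan v A <= kermx U)%MS.
    by apply/vspan_subP=> y /A0 y0; apply/sub_kermxP; rewrite vU y0 raddf0.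
  by rewrite vU => /matrixP/(_ 0 0); rewrite !mxE eqxx mulr1n.
(* A basis [B] of [X] avoiding [S (p i)] lies in earlier classes, where coordinate [p i] is zero.
   Since [b (p i)] has coordinate 1 there, it could be added to [B]. *)
apply/minsetP; split.
  rewrite SX //=; apply/forallP=> B; apply/implyP=> /maxsetP[/andP[sBX iB] maxB].
  apply/negP=> /eqP SB.
  have BN y : y \in B -> y \notin S (p i).
    by move=> yB; apply/negP=> yS; have := in_set0 y; rewrite -SB inE yS yB.
  have bB : b (p i) \notin B by apply: contraL (bS (p i)) => /BN.
  have : indep M (b (p i) |: B).
    rewrite iM /= vindepU1 //; rewrite iM in iB; rewrite [vindep _ _]iB.
    apply/negP=> vb; suff /eqP : w (b (p i)) 0 (p i) = 0 by rewrite wdiag ?oner_eq0.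
    apply: vspan_coord vb => y yB; have [j le_ji yj] := XP y (subsetP sBX y yB).
    apply: (later j) => //; rewrite ltn_neqAle le_ji andbT.
    by apply: contraNneq (BN y yB) => /val_inj <-.
  move=> ib; have := maxB (b (p i) |: B); rewrite ib subUset sBX sub1set.
  rewrite (subsetP (SX i (leqnn i))) // subsetUr => /(_ isT isT) eB.
  by rewrite -eB setU11 in bB.
(* If [D] omits [x] in [S (p i)], the part in [X] of the transversal [t] through [x] is a basis of
   [X] meeting [S (p i)] only in [x], hence missing [D]. *)
move=> D /andP[sDX /forallP hitD] sDS; apply/eqP; rewrite eqEsubset sDS /=.
apply/subsetP=> x xS; apply: contraT => xD.
pose t m := if m == p i then x else b m.
have tS m : t m \in S m by rewrite /t; case: eqVneq => [->|].
have [injt it] := trans t tS.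
pose J := [set p j | j : 'I_(mrank M) & (j <= i)%N].
have basisB : basis_in M X (t @: J).
  apply/maxsetP; split.
    apply/andP; split; last by apply: indep_sub it; apply: imsetS; apply: subset_predT.
    apply/subsetP=> _ /imsetP[_ /imsetP[j le_ji ->] ->].
    by apply: (subsetP (SX j _)); rewrite ?tS // inE in le_ji *.
  (* By triangularity all vectors of [X] lie in the span of the [b m] with [m] in [J], so
     independent subsets of [X] have at most [#|J|] elements. *)
  move=> B /andP[sBX iB] sJB; apply/esym/eqP; rewrite eqEcard sJB card_imset //.
  rewrite iM in iB; rewrite -(eqP iB); apply: leq_trans (leq_imset_card b J).
  apply: leq_trans (rank_vspan_le v _); apply: mxrankS; apply/vspan_subP=> y yB.
  have [j le_ji yj] := XP y (subsetP sBX y yB).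
  rewrite -wQ mulmx_sum_row summx_sub // => m _; rewrite rowK.
  have [mJ|mJ] := boolP (m \in J); first by rewrite scalemx_sub // vspan_mem ?imset_f.
  rewrite -(pK m) (later j) ?scale0r ?sub0mx // ltnNge; apply: contra mJ => le_mj.
  by apply/imsetP; exists (p' m); rewrite ?pK // inE (leq_trans le_mj).
have := hitD (t @: J); rewrite basisB /= => /set0Pn[y /setIP[yD /imsetP[m _ ey]]].
have mE : m = p i by apply: (@S_inj _ _ y); [rewrite ey | apply: (subsetP sDS)].
by move: yD; rewrite ey /t mE eqxx (negPf xD).
Qed.

End StandardColoring.

Theorem theorem4 (T : finType) (M : matroid T) :
  loopless M ->
  (binary M <->
   forall P : {set {set T}},
     coloring P -> #|P| = mrank M -> rainbow_circuit_free M P -> standard M P).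
Proof.
move=> loopM; split=> [binM P|stdM]; first exact: binary_standard.
exact/four_point_free_binary/standard_four_point_free.
Qed.
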